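(* Let $f_\theta(x) = \theta_{n+1}\,\phi_n(\theta_n\,\phi_{n-1}(\cdots\phi_1(\theta_1 x)))$ be a feed-forward network with parameter matrices $\theta_1,\dots,\theta_{n+1}$ and element-wise activations $\phi_i$, and let $\nabla^2_\theta\mathcal{L}\in\mathbb{R}^{N\times N}$ be the Hessian of the loss $\mathcal{L}$ with respect to the concatenated vector $\theta$ of all $N$ parameters. Assume there is a submatrix (block) of the Hessian $$\nabla^2_{\theta_i,\theta_j}\mathcal{L} := \left[\frac{\partial^2\mathcal{L}}{\partial\theta_i\,\partial\theta_j}\right]\in\mathbb{R}^{p\times q},\qquad p=|\theta_i|,\ q=|\theta_j|,$$ that has the matrix product structure $\nabla^2_{\theta_i,\theta_j}\mathcal{L}=ABC$, where $B=\theta_k$ for some index $k$ (depending on $i,j$) and $A$, $C$ are arbitrary matrices of compatible sizes. Then $$\sigma_1(\nabla^2_\theta\mathcal{L})\ \ge\ \sup_{r_1,r_2\ge 1}\ \sigma_{r_1}(A)\,\sigma_1(B)\,\sigma_{r_2}(C)\,\cos\theta\bigl(A_{r_1},(BC)_1\bigr)\,\cos\theta\bigl(B_1,C_{r_2}\bigr).$$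
   Context: $|\theta_i|$ is the number of entries of $\theta_i$; the block $\nabla^2_{\theta_i,\theta_j}\mathcal{L}$ is the matrix of second partial derivatives of $\mathcal{L}$ with respect to the vectorized $\theta_i$ (rows) and the vectorized $\theta_j$ (columns), which is a submatrix of $\nabla^2_\theta\mathcal{L}$. All derivatives involved are assumed to exist at the parameter point considered. $\sigma_1(X)\ge\sigma_2(X)\ge\cdots$ are the singular values of a real matrix $X$ in decreasing order. In the supremum, $r_1$ and $r_2$ range over the singular-value indices of $A$ and $C$ respectively (from $1$ to the smaller dimension). Principal-angle cosine: for matrices $X\in\mathbb{R}^{m\times n}$ and $Y\in\mathbb{R}^{n\times p}$ with fixed singular value decompositions $X=U_X\Sigma_XV_X^\top$, $Y=U_Y\Sigma_YV_Y^\top$, let $V_{X_r}$ be the matrix of the first $r$ columns of $V_X$ (top-$r$ right singular vectors of $X$) and $U_{Y_k}$ the matrix of the first $k$ columns of $U_Y$ (top-$k$ left singular vectors of $Y$). Then $\cos\theta(X_r,Y_k):=\sigma_{\min}(V_{X_r}^\top U_{Y_k})$, the $\min\{r,k\}$-th (smallest) singular value of the $r\times k$ matrix $V_{X_r}^\top U_{Y_k}$; it is the cosine of the largest principal angle between the two subspaces. *)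

(* Defs.v *)
From HB Require Import structures.
From mathcomp Require Import all_boot all_order all_algebra.
From mathcomp Require Import all_classical all_reals all_analysis.
Import Order.TTheory GRing.Theory Num.Theory.
Import numFieldNormedType.Exports.

Set Implicit Arguments.
Unset Strict Implicit.
Unset Printing Implicit Defensive.

Local Open Scope classical_set_scope.
Local Open Scope ring_scope.

Section SingularValues.
Context {R : realType}.

Definition rect_diag (m n : nat) (s : seq R) : 'M[R]_(m, n) :=
  \matrix_(i, j) (s`_i *+ (i == j :> nat)).

(* [svd_vals] lists the min(m, n) singular values in decreasing order; the
   left and right singular vectors are the columns of [svd_U] and [svd_V]. *)
Record svd (m n : nat) (X : 'M[R]_(m, n)) := SVD {
  svd_U : 'M[R]_m;
  svd_vals : seq R;
  svd_V : 'M[R]_n;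
  svd_U_orthogonal : svd_U^T *m svd_U = 1%:M;
  svd_V_orthogonal : svd_V^T *m svd_V = 1%:M;
  svd_vals_size : size svd_vals = minn m n;
  svd_vals_ge0 : {in svd_vals, forall x, 0 <= x};
  svd_vals_sorted : sorted (>=%R) svd_vals;
  svd_eq : X = svd_U *m rect_diag m n svd_vals *m svd_V^T
}.

(* The list of singular values is the same in every decomposition of X, and
   a decomposition always exists; the default [::] is never reached. *)
Definition singular_values (m n : nat) (X : 'M[R]_(m, n)) : seq R :=
  xget [::] [set s | exists D : svd X, svd_vals D = s].

(* Numbered from 1. *)
Definition sigma (r m n : nat) (X : 'M[R]_(m, n)) : R :=
  (singular_values X)`_r.-1.

(* Meant for r <= n; columns beyond n would be zero. *)
Definition first_cols (n r : nat) (V : 'M[R]_n) : 'M[R]_(n, r) :=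
  \matrix_(i, j) (if insub (val j) is Some j' then V i j' else 0).

Definition cos_theta (m n p : nat) (X : 'M[R]_(m, n)) (Y : 'M[R]_(n, p))
    (DX : svd X) (r : nat) (DY : svd Y) (k : nat) : R :=
  sigma (minn r k)
    ((first_cols r (svd_V DX))^T *m first_cols k (svd_U DY)).

End SingularValues.

Section Hessian.
Context {R : realType} {N : nat}.
Implicit Types (F : 'rV[R]_N -> R) (t : 'rV[R]_N) (a b : 'I_N).

Definition partial b F t : R := 'D_(delta_mx 0 b) F t.

(* Each second partial derivative at t exists: the inner partial derivative
   exists along the line used by the outer one. *)
Definition has_second_partials F t : Prop :=
  forall a b,
    (\forall h \near (0 : R), derivable F (t + h *: delta_mx 0 a) (delta_mx 0 b))
    /\ derivable (partial b F) t (delta_mx 0 a).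

Definition hessian F t : 'M[R]_N :=
  \matrix_(a, b) partial a (partial b F) t.

End Hessian.

Section Network.
Context {R : realType}.

(* [d l] is the width of layer l (layer 0 is the input). Layers are indexed
   from 0: [weight theta l] is the l.+1-st parameter matrix, and [phi l] is
   the l.+1-st activation. *)
Definition num_entries (d : nat -> nat) (l : nat) : nat := (d l.+1 * d l)%N.

(* The concatenation of the vectorized parameter matrices. *)
Definition params (n : nat) (d : nat -> nat) : Type :=
  'rV[R]_(\sum_(l < n.+1) num_entries d l).

Definition weight (n : nat) (d : nat -> nat) (theta : params n d)
    (l : 'I_n.+1) : 'M[R]_(d l.+1, d l) :=
  vec_mx (submxrow theta l).

Fixpoint preactivation (n : nat) (d : nat -> nat) (phi : nat -> R -> R)
    (theta : params n d) (l : nat) :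
    (l < n.+1)%N -> 'cV[R]_(d 0%N) -> 'cV[R]_(d l.+1) :=
  match l with
  | 0 => fun h x => weight theta (Ordinal h) *m x
  | l'.+1 => fun h x =>
      weight theta (Ordinal h)
        *m map_mx (phi l') (preactivation phi theta (ltnW h) x)
  end.

Definition network (n : nat) (d : nat -> nat) (phi : nat -> R -> R)
    (theta : params n d) : 'cV[R]_(d 0%N) -> 'cV[R]_(d n.+1) :=
  preactivation phi theta (ltnSn n).

(* [ell] evaluates an input-output map, e.g. by its empirical risk on a data
   set. *)
Definition loss (n : nat) (d : nat -> nat) (phi : nat -> R -> R)
    (ell : ('cV[R]_(d 0%N) -> 'cV[R]_(d n.+1)) -> R) (theta : params n d) : R :=
  ell (network phi theta).

(* Second derivatives with respect to the i-th (rows) and j-th (columns)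
   parameter matrices. *)
Definition hessian_block (n : nat) (d : nat -> nat) (F : params n d -> R)
    (theta : params n d) (i j : 'I_n.+1) :
    'M[R]_(num_entries d i, num_entries d j) :=
  submxblock (hessian F theta) i j.

End Network.
Arguments params : clear implicits.

(* Main.v *)
Require Import Defs.
From mathcomp Require Import all_boot all_order all_algebra.
From mathcomp Require Import all_classical all_reals all_analysis.
From mathcomp Require Import ring lra.
Import Order.TTheory GRing.Theory Num.Theory.
Import numFieldNormedType.Exports.

(** The largest singular value of a matrix is its operator norm for the
Euclidean norm, so passing to a block cannot increase it, and it is enough to
bound sigma_1 of the product A (B C) from below.

For any product X Y, test the operator norm on the top right singular vector v
of Y. Then Y v = sigma_1(Y) u, with u the top left singular vector of Y, and X
stretches u at least by sigma_r(X) times the length of the projection of u on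
the top r right singular vectors of X. That projection has coordinates
V_{X_r}^T u, an r x 1 matrix whose single singular value is its length, and is
therefore the principal-angle cosine. This is [sigma1_mulmx_ge]. It is applied
to X = A, Y = B C, and, transposed, to C^T and B^T: the singular values of a
matrix and of its transpose agree, and transposition swaps the left and right
singular vectors.

Since sigma is defined through an unspecified singular value decomposition,
two facts about decompositions are needed before it can be computed from a
given one. Uniqueness of the values ([svd_vals_unique]): their squares, padded
with zeros, are the roots of the characteristic polynomial of X^T X.
Existence ([svd_exists]): by induction on the size. A unit vector v on which
|X v| is maximal exists by compactness; changing bases by reflections that
send the first basis vector to v and to the direction of X v puts X in block
form with first column (a, 0), maximality kills the rest of the first row, and
induction applies to the remaining block. *)

Set Implicit Arguments.
Unset Strict Implicit.
Unset Printing Implicit Defensive.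

Local Open Scope classical_set_scope.
Local Open Scope ring_scope.

(** * Squared Euclidean norm *)

Section SquaredNorm.
Context {R : realType}.

Definition normsq (n : nat) (x : 'cV[R]_n) : R := \sum_i x i 0 ^+ 2.

Lemma normsqE n (x : 'cV[R]_n) : normsq x = (x^T *m x) 0 0.
Proof. by rewrite mxE; apply: eq_bigr => i _; rewrite mxE expr2. Qed.

Lemma normsq_ge0 n (x : 'cV[R]_n) : 0 <= normsq x.
Proof. by apply: sumr_ge0 => i _; exact: sqr_ge0. Qed.

Lemma normsq0 n : normsq (0 : 'cV[R]_n) = 0.
Proof. by rewrite normsqE mulmx0 mxE. Qed.

Lemma normsq_eq0 n (x : 'cV[R]_n) : (normsq x == 0) = (x == 0).
Proof.
apply/idP/eqP => [|->]; last by rewrite normsq0.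
rewrite psumr_eq0 => [/allP x0|i _]; last exact: sqr_ge0.
by apply/colP => i; rewrite mxE; have := x0 i (mem_index_enum _);
  rewrite /= sqrf_eq0 => /eqP.
Qed.

Lemma normsqZ n a (x : 'cV[R]_n) : normsq (a *: x) = a ^+ 2 * normsq x.
Proof.
by rewrite /normsq mulr_sumr; apply: eq_bigr => i _; rewrite mxE exprMn.
Qed.

Lemma normsq_isometry m n (U : 'M[R]_(m, n)) (x : 'cV[R]_n) :
  U^T *m U = 1%:M -> normsq (U *m x) = normsq x.
Proof.
by move=> U1; rewrite !normsqE trmx_mul mulmxA -(mulmxA _ _ U) U1 mulmx1.
Qed.

Lemma normsq_col_mx m n (x : 'cV[R]_m) (y : 'cV[R]_n) :
  normsq (col_mx x y) = normsq x + normsq y.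
Proof. by rewrite !normsqE tr_col_mx mul_row_col mxE. Qed.

Lemma normsq_scalar (a : R) : normsq (a%:M : 'cV_1) = a ^+ 2.
Proof. by rewrite /normsq big_ord1 mxE mulr1n. Qed.

Lemma normsq_delta n (i : 'I_n) : normsq (delta_mx i 0) = 1.
Proof.
rewrite /normsq (bigD1 i) //= mxE !eqxx expr1n big1 ?addr0 // => j ji.
by rewrite mxE (negPf ji) expr0n.
Qed.

End SquaredNorm.

(** * Action of a matrix on vectors through a singular value decomposition *)

Section SvdAction.
Context {R : realType}.

Lemma rect_diag_gram m n (s : seq R) : (size s <= m)%N ->
  (rect_diag m n s)^T *m rect_diag m n s = diag_mx (\row_j s`_j ^+ 2).
Proof.
move=> sm; apply/matrixP => j j'; rewrite !mxE.
have [jm|mj] := ltnP j m; last first.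
  rewrite big1 ?nth_default ?expr0n ?mul0rn ?(leq_trans sm) // => i _.
  by rewrite !mxE ltn_eqF ?mul0r // (leq_trans (ltn_ord i)).
rewrite (bigD1 (Ordinal jm)) //= big1 => [|i ij]; last first.
  rewrite !mxE (_ : (i == j :> nat) = false) ?mul0r //.
  by apply: contraNF ij => /eqP ij; apply/eqP/val_inj.
by rewrite !mxE eqxx mulr1n addr0 expr2 mulrnAr.
Qed.

(** An eigendecomposition of the Gram matrix, whose eigenvalues do not depend
on the decomposition of X. *)
Lemma svd_gram m n (X : 'M[R]_(m, n)) (D : svd X) :
  X^T *m X = svd_V D *m diag_mx (\row_j (svd_vals D)`_j ^+ 2) *m (svd_V D)^T.
Proof.
rewrite -(rect_diag_gram (m := m)); last by rewrite svd_vals_size geq_minl.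
rewrite {1 2}(svd_eq D) !trmx_mul trmxK !mulmxA.
by rewrite -(mulmxA _ _ (svd_U D)) svd_U_orthogonal mulmx1.
Qed.

Lemma svd_V_orthogonal_tr m n (X : 'M[R]_(m, n)) (D : svd X) :
  svd_V D *m (svd_V D)^T = 1%:M.
Proof. exact/mulmx1C/svd_V_orthogonal. Qed.

(** Everything about |X x| is read off in the coordinates of x on the right
singular vectors; nth reads the value 0 for the coordinates beyond the
min(m, n) singular values. *)
Lemma normsq_svd m n (X : 'M[R]_(m, n)) (D : svd X) (x : 'cV[R]_n) :
  normsq (X *m x) =
  \sum_(j < n) (svd_vals D)`_j ^+ 2 * (((svd_V D)^T *m x) j 0) ^+ 2.
Proof.
rewrite normsqE trmx_mul mulmxA -(mulmxA _ _ X) (svd_gram D) !mulmxA.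
rewrite -[x^T *m svd_V D]trmxK trmx_mul trmxK -mulmxA mul_mx_diag mxE.
by apply: eq_bigr => j _; rewrite !mxE; ring.
Qed.

Lemma svd_vals_nth_ge0 m n (X : 'M[R]_(m, n)) (D : svd X) i :
  0 <= (svd_vals D)`_i.
Proof.
have [si|si] := ltnP i (size (svd_vals D)); last by rewrite nth_default.
by apply/(svd_vals_ge0 (s := D))/mem_nth.
Qed.

Lemma svd_vals_nth_le m n (X : 'M[R]_(m, n)) (D : svd X) i j :
  (i <= j)%N -> (svd_vals D)`_j <= (svd_vals D)`_i.
Proof.
move=> ij; have [sj|sj] := ltnP j (size (svd_vals D)); last first.
  by rewrite [X in X <= _]nth_default ?svd_vals_nth_ge0.
apply: (sorted_leq_nth (leT := >=%R) _ _ 0 (svd_vals_sorted D)) => //.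
  by move=> a b c /= ba ca; exact: le_trans ca ba.
  by move=> a /=.
by rewrite inE (leq_ltn_trans ij).
Qed.

Lemma char_poly_gram m n (X : 'M[R]_(m, n)) (D : svd X) :
  char_poly (X^T *m X) =
  \prod_(a <- [seq (svd_vals D)`_j ^+ 2 | j : 'I_n]) ('X - a%:P).
Proof.
set V := svd_V D; set d : 'rV[R]_n := \row_j (svd_vals D)`_j ^+ 2.
have VV : map_mx polyC V *m (map_mx polyC V)^T = 1%:M.
  by rewrite map_trmx -map_mxM svd_V_orthogonal_tr map_mx1.
have -> : char_poly (X^T *m X) = char_poly (diag_mx d).
  rewrite /char_poly.
  have -> : char_poly_mx (X^T *m X) =
      map_mx polyC V *m char_poly_mx (diag_mx d) *m (map_mx polyC V)^T.
    rewrite /char_poly_mx (svd_gram D) mulmxBr mulmxBl !map_mxM -map_trmx.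
    by rewrite -/V mul_mx_scalar -scalemxAl VV scalemx1.
  by rewrite !det_mulmx mulrAC -det_mulmx VV det1 mul1r.
rewrite char_poly_trig ?diag_mx_is_trig // big_map big_enum.
by apply: eq_bigr => j _; rewrite !mxE eqxx.
Qed.

(** Both lists of squares are the roots of the characteristic polynomial of
X^T X, so they are permutations of each other; being sorted, they are equal. *)
Lemma svd_vals_unique m n (X : 'M[R]_(m, n)) (D D' : svd X) :
  svd_vals D = svd_vals D'.
Proof.
have nth_sq (E : svd X) i : (i < n)%N ->
    [seq (svd_vals E)`_j ^+ 2 | j : 'I_n]`_i = (svd_vals E)`_i ^+ 2.
  by move=> lt_in; rewrite (nth_map (Ordinal lt_in)) ?size_enum_ord ?nth_enum_ord.
have sorted_sq (E : svd X) :
    sorted >=%R [seq (svd_vals E)`_j ^+ 2 | j : 'I_n].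
  apply/(sortedP 0) => i; rewrite size_map size_enum_ord => lt_in.
  rewrite !nth_sq // 1?ltnW //=.
  by rewrite lerXn2r ?nnegrE ?svd_vals_nth_ge0 // svd_vals_nth_le.
have /(sorted_eq _ _ (sorted_sq D) (sorted_sq D')) eqs :
    perm_eq [seq (svd_vals D)`_j ^+ 2 | j : 'I_n]
            [seq (svd_vals D')`_j ^+ 2 | j : 'I_n].
  by apply: prod_XsubC_eq; rewrite -!char_poly_gram.
have {}eqs : [seq (svd_vals D)`_j ^+ 2 | j : 'I_n] =
             [seq (svd_vals D')`_j ^+ 2 | j : 'I_n].
  apply: eqs => [a b c /= ba cb|a b ba]; first exact: le_trans cb ba.
  exact/esym/le_anti.
apply: (@eq_from_nth _ 0) => [|i]; first by rewrite !svd_vals_size.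
rewrite svd_vals_size leq_min => /andP[_ lt_in].
move/(congr1 (fun s => s`_i)): eqs; rewrite !nth_sq //.
by move/eqP; rewrite eqrXn2 ?svd_vals_nth_ge0 // => /eqP.
Qed.

End SvdAction.

(** * Maximal directions and reflections *)

Section MaximalDirection.
Context {R : realType}.

Lemma continuous_normsq_mul m n (X : 'M[R]_(m, n)) :
  continuous (fun r : 'rV[R]_n => normsq (X *m r^T)).
Proof.
apply: continuous_big => [|i _]; first exact: add_continuous.
suff Xi_cont : continuous (fun r : 'rV[R]_n => (X *m r^T) i 0).
  by move=> r; under eq_fun do rewrite expr2; exact: cvgM (Xi_cont r) (Xi_cont r).
under eq_fun do rewrite mxE.
apply: continuous_big => [|j _ r]; first exact: add_continuous.
under eq_fun do rewrite mxE.
by apply: continuousM; [exact: cst_continuous|exact: coord_continuous].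
Qed.

(** A continuous function attains its maximum on the unit sphere; homogeneity
extends the bound to all vectors. *)
Lemma ex_maximal_direction m n (X : 'M[R]_(m, n.+1)) :
  exists2 v : 'cV[R]_n.+1, normsq v = 1 &
    forall x, normsq (X *m x) <= normsq (X *m v) * normsq x.
Proof.
(* The factor 1%:M lets the continuity lemma above apply to the sphere as
well as to the maximized function. *)
pose sphere := [set r : 'rV[R]_n.+1 | normsq (1%:M *m r^T) = 1].
have sphere0 : sphere !=set0.
  exists (delta_mx 0 0).
  by rewrite /sphere /= mul1mx trmx_delta normsq_delta.
have sphere_compact : compact sphere.
  have box : compact [set r : 'rV[R]_n.+1 | forall i, `[-1, 1]%classic (r ord0 i)].
    apply: (@rV_compact R n.+1 (fun=> `[-1, 1]%classic)) => _.
    exact: segment_compact.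
  apply: subclosed_compact _ box _.
    have /continuous_closedP := @continuous_normsq_mul _ n.+1 1%:M.
    by move=> /(_ [set 1]); apply; exact: closed_eq.
  move=> r; rewrite /sphere /= mul1mx => r1 i.
  rewrite /= in_itv /= -ler_norml -(@ler_pXn2r _ 2) ?nnegrE // expr1n.
  rewrite real_normK ?num_real // -r1 /normsq (bigD1 i) //= mxE lerDl.
  by apply: sumr_ge0 => j _; exact: sqr_ge0.
have Xsphere : {within sphere, continuous (fun r => normsq (X *m r^T))}.
  exact/continuous_subspaceT/continuous_normsq_mul.
have [r rS rmax] := compact_EVT_max sphere0 sphere_compact Xsphere.
exists r^T; first by move: rS; rewrite inE /sphere /= mul1mx.
move=> x; have [->|x0] := eqVneq x 0.
  by rewrite mulmx0 !normsq0 mulr0.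
have Nx : 0 < normsq x by rewrite lt_def normsq_ge0 normsq_eq0 x0.
pose a := (Num.sqrt (normsq x))^-1.
have a2 : a ^+ 2 = (normsq x)^-1 by rewrite exprVn sqr_sqrtr // ltW.
have /rmax : (a *: x)^T \in sphere.
  by rewrite inE /sphere /= mul1mx trmxK normsqZ a2 mulVf // gt_eqF.
by rewrite trmxK -scalemxAr normsqZ a2 ler_pdivrMl // mulrC.
Qed.

(** The Householder reflection exchanging u and the first basis vector: it
reverses w = u - e_0 and fixes the orthogonal complement of w. *)
Lemma ex_orthogonal_first_col n (u : 'cV[R]_n.+1) : normsq u = 1 ->
  exists2 U : 'M[R]_n.+1, U^T *m U = 1%:M & U *m delta_mx 0 0 = u.
Proof.
move=> u1.
(* When w = 0 the coefficient c is 2 / 0 = 0 and the formula gives the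
identity, which then maps e_0 to u. *)
pose w := u - delta_mx 0 0; pose c := 2 / normsq w.
have ww : w^T *m w = (normsq w)%:M by rewrite [LHS]mx11_scalar -normsqE.
have Nw : normsq w = 2 - 2 * u 0 0.
  move: u1; rewrite /normsq !big_ord_recl => u1; under eq_bigr => i _.
    rewrite !mxE /= subr0; over.
  by rewrite !mxE /=; lra.
pose G := w *m w^T.
have GG : G *m G = normsq w *: G.
  by rewrite /G mulmxA -(mulmxA w) ww mul_mx_scalar -scalemxAl.
have GT : (1%:M - c *: G)^T = 1%:M - c *: G.
  apply/matrixP => i j; rewrite !mxE (eq_sym j); congr (_ - c * _).
  by apply: eq_bigr => k _; rewrite !mxE mulrC.
exists (1%:M - c *: G).
  rewrite GT mulmxBl mul1mx mulmxBr mulmx1 -scalemxAl -scalemxAr GG !scalerA.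
  have -> : c * c * normsq w = c + c.
    rewrite /c; have [->|w0] := eqVneq (normsq w) 0; first by rewrite invr0; ring.
    by field.
  by rewrite scalerDl opprB addrK subrK.
rewrite mulmxBl mul1mx -scalemxAl /G -mulmxA.
have -> : w^T *m delta_mx 0 0 = (u 0 0 - 1)%:M.
  by rewrite [LHS]mx11_scalar -[_ *m _]trmxK trmx_mul trmx_delta trmxK -rowE !mxE !eqxx.
have [w0|w0] := eqVneq (normsq w) 0.
  move/eqP: (w0); rewrite normsq_eq0 => /eqP w_eq0.
  rewrite w_eq0 mul0mx scaler0 subr0.
  by apply/eqP; rewrite eq_sym -subr_eq0 -/w w_eq0.
rewrite mul_mx_scalar scalerA (_ : c * _ = -1).
  by rewrite scaleN1r opprK /w addrC subrK.
by rewrite /c Nw; field; rewrite -Nw.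
Qed.

End MaximalDirection.

(** * Existence of singular value decompositions *)

Section SvdExistence.
Context {R : realType}.

Lemma normsq_col_svd_V m n (X : 'M[R]_(m, n)) (D : svd X) (j : 'I_n) :
  normsq (col j (svd_V D)) = 1.
Proof. by rewrite colE (normsq_isometry _ (svd_V_orthogonal D)) normsq_delta. Qed.

Lemma normsq_mul_col_svd_V m n (X : 'M[R]_(m, n)) (D : svd X) (j : 'I_n) :
  normsq (X *m col j (svd_V D)) = (svd_vals D)`_j ^+ 2.
Proof.
rewrite (normsq_svd D) colE mulmxA (svd_V_orthogonal D) mul1mx.
rewrite (bigD1 j) //= mxE !eqxx expr1n mulr1 big1 ?addr0 // => i ij.
by rewrite mxE (negPf ij) expr0n mulr0.
Qed.

Lemma rect_diag_cons m n a (s : seq R) :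
  rect_diag (1 + m) (1 + n) (a :: s) = block_mx a%:M 0 0 (rect_diag m n s).
Proof.
rewrite -[LHS]submxK; congr block_mx; apply/matrixP => i j.
all: by rewrite !mxE ?ord1 //=.
Qed.

(** The bound on X says that its singular values are at most a, so that putting
a in front keeps the list sorted. *)
Lemma block_svd m n a (X : 'M[R]_(m, n)) :
  0 <= a -> (forall x, normsq (X *m x) <= a ^+ 2 * normsq x) ->
  svd X -> svd (block_mx a%:M 0 0 X : 'M[R]_(1 + m, 1 + n)).
Proof.
move=> a0 Xa D.
pose U : 'M[R]_(1 + m) := block_mx 1%:M 0 0 (svd_U D).
pose V : 'M[R]_(1 + n) := block_mx 1%:M 0 0 (svd_V D).
apply: (@SVD _ _ _ _ U (a :: svd_vals D) V).
- rewrite tr_block_mx !trmx0 trmx1 mulmx_block svd_U_orthogonal.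
  by rewrite !(mulmx0, mul0mx, mulmx1, addr0, add0r) -scalar_mx_block.
- rewrite tr_block_mx !trmx0 trmx1 mulmx_block svd_V_orthogonal.
  by rewrite !(mulmx0, mul0mx, mulmx1, addr0, add0r) -scalar_mx_block.
- by rewrite /= svd_vals_size -minnSS.
- by move=> x; rewrite inE => /predU1P[->//|]; exact: svd_vals_ge0.
- have := svd_vals_sorted D; case E : (svd_vals D) => [//|b s] /= ->; rewrite andbT.
  have sz : (0 < minn m n)%N by rewrite -(svd_vals_size D) E.
  have n0 : (0 < n)%N by move: sz; rewrite leq_min => /andP[].
  have := Xa (col (Ordinal n0) (svd_V D)).
  rewrite normsq_mul_col_svd_V normsq_col_svd_V mulr1 E /=.
  rewrite ler_pXn2r // nnegrE //.
  by apply: (svd_vals_ge0 (s := D)); rewrite E mem_head.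
- rewrite rect_diag_cons tr_block_mx !trmx0 trmx1 !mulmx_block.
  by rewrite !(mulmx0, mul0mx, mul1mx, mulmx1, addr0, add0r) -svd_eq.
Qed.

(** A nonzero w would let the first row do better than a: it maps the vector
(a, w^T) to a^2 + |w|^2, whose square exceeds a^2 (a^2 + |w|^2). *)
Lemma ursubmx_eq0_of_max m n a (w : 'rV[R]_n) (X : 'M[R]_(m, n)) :
  (forall x, normsq (block_mx a%:M w 0 X *m x) <= a ^+ 2 * normsq x) -> w = 0.
Proof.
move=> max; apply: trmx_inj; rewrite trmx0; apply/eqP; rewrite -normsq_eq0.
have ww : w *m w^T = (normsq w^T)%:M by rewrite [LHS]mx11_scalar normsqE trmxK.
have := max (col_mx a%:M w^T); set t := normsq w^T in ww *.
rewrite mul_block_col mul0mx add0r mul_scalar_mx scale_scalar_mx ww.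
rewrite -raddfD !normsq_col_mx !normsq_scalar -/t => max_t.
have t_ge0 : 0 <= t := normsq_ge0 _.
have rest_ge0 : 0 <= normsq (X *m w^T) := normsq_ge0 _.
rewrite -[t == 0]sqrf_eq0 eq_le sqr_ge0 andbT.
have := mulr_ge0 (sqr_ge0 a) t_ge0.
nra.
Qed.

Lemma svd_orthogonal_mul m n (X : 'M[R]_(m, n)) (U : 'M[R]_m) (V : 'M[R]_n) :
  U^T *m U = 1%:M -> V^T *m V = 1%:M -> svd (U^T *m X *m V) -> svd X.
Proof.
move=> U1 V1 [U' s V' U'1 V'1 size_s s_ge0 s_sorted eqX].
apply: (@SVD _ _ _ _ (U *m U') s (V *m V')) => //.
- by rewrite trmx_mul mulmxA -(mulmxA _ _ U) U1 mulmx1.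
- by rewrite trmx_mul mulmxA -(mulmxA _ _ V) V1 mulmx1.
- rewrite trmx_mul mulmxA -!(mulmxA U) -eqX !mulmxA (mulmx1C U1) mul1mx.
  by rewrite -mulmxA (mulmx1C V1) mulmx1.
Qed.

Lemma svd_exists m n (X : 'M[R]_(m, n)) : inhabited (svd X).
Proof.
have trivial_svd k l (Y : 'M[R]_(k, l)) : minn k l = 0%N -> inhabited (svd Y).
  move=> kl0; split; apply: (@SVD _ _ _ _ 1%:M [::] 1%:M); rewrite ?trmx1 ?mulmx1 //.
  apply/matrixP => i j; have := leq_ltn_trans (leq0n i) (ltn_ord i).
  have := leq_ltn_trans (leq0n j) (ltn_ord j).
  by move=> l0 k0; have := leq_min 1 k l; rewrite kl0 k0 l0.
elim: m n X => [|m IHm] n X; first by apply: trivial_svd; rewrite min0n.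
case: n X => [|n] X; first by apply: trivial_svd; rewrite minn0.
have [v v1 Xv] := ex_maximal_direction X.
pose s := Num.sqrt (normsq (X *m v)).
have s2 : s ^+ 2 = normsq (X *m v) by rewrite sqr_sqrtr ?normsq_ge0.
have [u u1 Xvu] : exists2 u, normsq u = 1 & X *m v = s *: u.
  have [s0|s_neq0] := eqVneq s 0.
    (* If the maximum is 0, any unit vector serves as u. *)
    exists (delta_mx 0 0); first exact: normsq_delta.
    by apply/eqP; rewrite s0 scale0r -normsq_eq0 -s2 s0 expr0n.
  exists (s^-1 *: (X *m v)); last by rewrite scalerA mulfV // scale1r.
  by rewrite normsqZ -s2 exprVn mulVf // sqrf_eq0.
have [U U1 Uu] := ex_orthogonal_first_col u1.
have [V V1 Vv] := ex_orthogonal_first_col v1.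
(* Y is abstract, so that its entries are not expanded into sums below. *)
have [Y YE] : exists Y : 'M[R]_(1 + m, 1 + n), Y = U^T *m X *m V by eexists.
have Y_max x : normsq (Y *m x) <= s ^+ 2 * normsq x.
  rewrite YE -!mulmxA normsq_isometry ?trmxK ?(mulmx1C U1) //.
  by rewrite s2 -(normsq_isometry x V1).
have colY : col (0 : 'I_n.+1) Y = s *: (delta_mx 0 0 : 'cV[R]_m.+1).
  by rewrite colE YE -!mulmxA Vv Xvu -scalemxAr -Uu mulmxA U1 mul1mx.
have Y_block : Y = block_mx s%:M (ursubmx Y) 0 (drsubmx Y).
  rewrite -[LHS]submxK; congr block_mx; apply/matrixP => i j.
    have := congr1 (fun M : 'cV[R]_(1 + m) => M (lshift _ i) 0) colY.
    by rewrite !mxE !ord1 /= mulr1 => <-; congr (Y _ _); apply: val_inj.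
  have := congr1 (fun M : 'cV[R]_(1 + m) => M (rshift _ i) 0) colY.
  by rewrite !mxE !ord1 /= mulr0 => <-; congr (Y _ _); apply: val_inj.
have w0 : ursubmx Y = 0.
  by apply: (@ursubmx_eq0_of_max _ _ s _ (drsubmx Y)); rewrite -Y_block.
rewrite w0 in Y_block.
have [D] := IHm _ (drsubmx Y).
split; apply: (svd_orthogonal_mul U1 V1); rewrite -YE Y_block.
apply: block_svd D; first exact: sqrtr_ge0.
move=> x; have := Y_max (col_mx 0 x).
by rewrite {1}Y_block mul_block_col !mul0mx !mulmx0 !add0r !normsq_col_mx normsq0 !add0r.
Qed.

End SvdExistence.

(** * The largest singular value as an operator norm *)

Section LargestSingularValue.
Context {R : realType}.

(** The singular values chosen in the definition of sigma may be replaced by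
those of any decomposition at hand. *)
Lemma sigma_svd m n (X : 'M[R]_(m, n)) (D : svd X) r :
  sigma r X = (svd_vals D)`_r.-1.
Proof.
have ex : exists s, exists D' : svd X, svd_vals D' = s by exists (svd_vals D), D.
have [D' D'E] := xgetPex [::] ex.
by rewrite /sigma /singular_values -D'E (svd_vals_unique D' D).
Qed.

Lemma sigma_ge0 m n (X : 'M[R]_(m, n)) r : 0 <= sigma r X.
Proof. by have [D] := svd_exists X; rewrite (sigma_svd D) svd_vals_nth_ge0. Qed.

Lemma normsq_mul_le_sigma1 m n (X : 'M[R]_(m, n)) x :
  normsq (X *m x) <= sigma 1 X ^+ 2 * normsq x.
Proof.
have [D] := svd_exists X; rewrite (sigma_svd D) (normsq_svd D).
have VT1 : (svd_V D)^T^T *m (svd_V D)^T = 1%:M by rewrite trmxK svd_V_orthogonal_tr.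
rewrite -(normsq_isometry x VT1) mulr_sumr.
apply: ler_sum => j _; apply: ler_wpM2r; first exact: sqr_ge0.
by rewrite lerXn2r ?nnegrE ?svd_vals_nth_ge0 // svd_vals_nth_le.
Qed.

(** Test on the top right singular vector. *)
Lemma sigma1_le m n (X : 'M[R]_(m, n)) c : 0 <= c ->
  (forall x, normsq (X *m x) <= c ^+ 2 * normsq x) -> sigma 1 X <= c.
Proof.
move=> c0 Xc; have [D] := svd_exists X; rewrite (sigma_svd D) /=.
case: n => [|n] in X D Xc *.
  by rewrite nth_default // svd_vals_size minn0.
have := Xc (col 0 (svd_V D)).
rewrite normsq_mul_col_svd_V normsq_col_svd_V mulr1.
by rewrite ler_pXn2r // nnegrE ?svd_vals_nth_ge0.
Qed.

Lemma rect_diag_tr m n (s : seq R) : (rect_diag m n s)^T = rect_diag n m s.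
Proof.
apply/matrixP => i j; rewrite !mxE eq_sym.
by case: eqP => [->|] //; rewrite !mulr0n.
Qed.

(** Transparent, so that the singular vectors of the transpose unfold to those
of X in [cos_theta_tr]. *)
Definition svd_tr m n (X : 'M[R]_(m, n)) (D : svd X) : svd X^T.
Proof.
refine (@SVD R n m X^T (svd_V D) (svd_vals D) (svd_U D) _ _ _ _ _ _).
- exact: svd_V_orthogonal.
- exact: svd_U_orthogonal.
- by rewrite minnC svd_vals_size.
- exact: svd_vals_ge0.
- exact: svd_vals_sorted.
- by rewrite {1}(svd_eq D) !trmx_mul trmxK rect_diag_tr mulmxA.
Defined.

Lemma sigma_tr m n (X : 'M[R]_(m, n)) r : sigma r X^T = sigma r X.
Proof. by have [D] := svd_exists X; rewrite (sigma_svd D) (sigma_svd (svd_tr D)). Qed.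

Lemma cos_theta_tr m n p (X : 'M[R]_(m, n)) (Y : 'M[R]_(n, p)) (DX : svd X)
    (DY : svd Y) r k :
  cos_theta DX r DY k = cos_theta (svd_tr DY) k (svd_tr DX) r.
Proof. by rewrite /cos_theta -sigma_tr trmx_mul trmxK minnC. Qed.

(** A column acts on the scalar a by scaling a by its length. This bounds a
principal-angle cosine by the length of the projection it measures. *)
Lemma sigma1_col_le n (x : 'cV[R]_n) : sigma 1 x ^+ 2 <= normsq x.
Proof.
rewrite -[leRHS]sqr_sqrtr ?normsq_ge0 // lerXn2r ?nnegrE ?sigma_ge0 ?sqrtr_ge0 //.
apply: sigma1_le; first exact: sqrtr_ge0.
move=> a; rewrite [a]mx11_scalar mul_mx_scalar normsqZ normsq_scalar.
by rewrite sqr_sqrtr ?normsq_ge0 // mulrC.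
Qed.

(** Keep the terms of [normsq_svd] along the first r right singular vectors and
bound each of their singular values below by the r-th. *)
Lemma sigma_normsq_first_cols_le m n (X : 'M[R]_(m, n)) (D : svd X) r x :
  (1 <= r <= n)%N ->
  sigma r X ^+ 2 * normsq ((first_cols r (svd_V D))^T *m x) <= normsq (X *m x).
Proof.
move=> /andP[r_gt0 rn]; rewrite (normsq_svd D) (sigma_svd D) mulr_sumr.
pose F (j : 'I_n) := (svd_vals D)`_j ^+ 2 * ((svd_V D)^T *m x) j 0 ^+ 2.
rewrite -/(\sum_j F j).
have VE (j : 'I_r) : ((first_cols r (svd_V D))^T *m x) j 0
    = ((svd_V D)^T *m x) (widen_ord rn j) 0.
  rewrite !mxE; apply: eq_bigr => i _; rewrite !mxE.
  case: insubP => [j' _ j'E|]; last by rewrite (leq_trans (ltn_ord j)).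
  by congr (svd_V D _ _ * _); apply: val_inj.
have F_ge0 j : 0 <= F j by rewrite mulr_ge0 ?sqr_ge0.
rewrite [leRHS](bigID (fun j : 'I_n => (j < r)%N)) /=.
rewrite -[leLHS]addr0; apply: lerD; last exact: sumr_ge0.
rewrite (big_ord_narrow rn); apply: ler_sum => j _; rewrite VE.
apply: ler_wpM2r; first exact: sqr_ge0.
rewrite lerXn2r ?nnegrE ?svd_vals_nth_ge0 // svd_vals_nth_le //=.
by rewrite -ltnS prednK.
Qed.

Lemma first_cols1E n (V : 'M[R]_n.+1) : first_cols 1 V = V *m delta_mx 0 0.
Proof.
rewrite -colE; apply/colP => i; rewrite !mxE.
case: insubP => [j _ j0|//]; congr (V i _).
exact: val_inj.
Qed.

Lemma svd_mul_first_cols m n (X : 'M[R]_(m.+1, n.+1)) (D : svd X) :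
  X *m first_cols 1 (svd_V D) = sigma 1 X *: first_cols 1 (svd_U D).
Proof.
rewrite (sigma_svd D) !first_cols1E {1}(svd_eq D) !mulmxA -(mulmxA _ _ (svd_V D)).
rewrite svd_V_orthogonal mulmx1 -mulmxA scalemxAr; congr (_ *m _).
rewrite -colE; apply/colP => i; rewrite !mxE andbT.
by case: i => -[|i] i_lt /=; rewrite ?mulr1 ?mulr0.
Qed.

(** The top right singular vector of Y is sent to sigma_1(Y) u, u the top left
singular vector, and X stretches the part of u along its own top r right
singular vectors at least by sigma_r(X). *)
Lemma sigma1_mulmx_ge m n p (X : 'M[R]_(m, n)) (Y : 'M[R]_(n, p))
    (DX : svd X) (DY : svd Y) r :
  (0 < p)%N -> (1 <= r <= n)%N ->
  sigma r X * sigma 1 Y * cos_theta DX r DY 1 <= sigma 1 (X *m Y).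
Proof.
case: p => // p in Y DY *; case: n => [|n] in X Y DX DY *.
  by move=> _ /andP[r1 r0]; have := leq_trans r1 r0.
move=> _ r_bounds; rewrite /cos_theta.
have -> : minn r 1 = 1%N by apply/minn_idPr; case/andP: r_bounds.
set u := first_cols 1 (svd_U DY); set c := sigma 1 _.
rewrite -(@ler_pXn2r _ 2) ?nnegrE ?mulr_ge0 ?sigma_ge0 //.
have v1 : normsq (first_cols 1 (svd_V DY)) = 1.
  by rewrite first_cols1E -colE normsq_col_svd_V.
have := normsq_mul_le_sigma1 (X *m Y) (first_cols 1 (svd_V DY)).
rewrite v1 mulr1; apply: le_trans.
rewrite -mulmxA svd_mul_first_cols -scalemxAr normsqZ -/u.
rewrite exprMn [in leLHS]exprMn mulrAC mulrC ler_wpM2l ?sqr_ge0 //.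
apply: le_trans (sigma_normsq_first_cols_le DX u r_bounds).
by rewrite ler_wpM2l ?sqr_ge0 // sigma1_col_le.
Qed.

(** Selecting columns amounts to extending the vector by zeros, an isometry. *)
Lemma sigma1_colsub_le m n k (g : 'I_k -> 'I_n) (X : 'M[R]_(m, n)) :
  injective g -> sigma 1 (colsub g X) <= sigma 1 X.
Proof.
move=> g_inj; apply: sigma1_le => [|x]; first exact: sigma_ge0.
have G1 : (colsub g 1%:M)^T *m colsub g 1%:M = 1%:M :> 'M[R]_k.
  rewrite trmx_mxsub trmx1 mul_rowsub_mx mul1mx.
  by apply/matrixP => i j; rewrite !mxE (inj_eq g_inj).
rewrite -[X in colsub g X]mulmx1 -mulmx_colsub -mulmxA -(normsq_isometry x G1).
exact: normsq_mul_le_sigma1.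
Qed.

Lemma sigma1_mxsub_le m n k l (f : 'I_k -> 'I_m) (g : 'I_l -> 'I_n)
    (X : 'M[R]_(m, n)) :
  injective f -> injective g -> sigma 1 (mxsub f g X) <= sigma 1 X.
Proof.
move=> f_inj g_inj; rewrite mxsubcr.
apply: le_trans (sigma1_colsub_le _ g_inj) _.
rewrite -sigma_tr trmx_mxsub -[leRHS]sigma_tr; exact: sigma1_colsub_le.
Qed.

End LargestSingularValue.

(** * The Hessian bound *)

Theorem theorem3 (R : realType) (n : nat) (d : nat -> nat)
    (d_gt0 : forall l : nat, (l <= n.+1)%N -> (0 < d l)%N)
    (phi : nat -> R -> R)
    (ell : ('cV[R]_(d 0%N) -> 'cV[R]_(d n.+1)) -> R)
    (theta : params R n d)
    (L_diff : has_second_partials (loss phi ell) theta)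
    (i j k : 'I_n.+1)
    (A : 'M[R]_(num_entries d i, d k.+1)) (B : 'M[R]_(d k.+1, d k))
    (C : 'M[R]_(d k, num_entries d j))
    (B_weight : B = weight theta k)
    (block_eq : hessian_block (loss phi ell) theta i j = A *m B *m C)
    (DA : svd A) (DB : svd B) (DC : svd C) (DBC : svd (B *m C)) :
  sigma 1 (hessian (loss phi ell) theta) >=
  sup [set x : R | exists r1 r2 : nat,
    [/\ (1 <= r1 <= minn (num_entries d i) (d k.+1))%N,
        (1 <= r2 <= minn (d k) (num_entries d j))%N
      & x = sigma r1 A * sigma 1 B * sigma r2 C
            * cos_theta DA r1 DBC 1 * cos_theta DB 1 DC r2]].
Proof.
have width_gt0 (l : 'I_n.+1) : (0 < d l)%N by rewrite d_gt0 // ltnW // ltnW.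
have out_width_gt0 (l : 'I_n.+1) : (0 < d l.+1)%N by rewrite d_gt0.
have entries_gt0 (l : 'I_n.+1) : (0 < num_entries d l)%N.
  by rewrite /num_entries muln_gt0 out_width_gt0 width_gt0.
apply: ge_sup.
  exists (sigma 1 A * sigma 1 B * sigma 1 C
          * cos_theta DA 1 DBC 1 * cos_theta DB 1 DC 1), 1%N, 1%N.
  by rewrite !leq_min !entries_gt0 width_gt0 out_width_gt0.
move=> _ [r1 [r2 [/andP[r1_gt0 r1_le] /andP[r2_gt0 r2_le] ->]]].
move: r1_le r2_le; rewrite !leq_min => /andP[_ r1_le] /andP[r2_le _].
have BC_ge : sigma 1 B * sigma r2 C * cos_theta DB 1 DC r2 <= sigma 1 (B *m C).
  (* B, acting from the left on C, acts from the right on C^T: transposing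
  makes C^T the stretching factor and B^T the tested one. *)
  rewrite cos_theta_tr -(sigma_tr B) -(sigma_tr C) -(sigma_tr (B *m C)) trmx_mul.
  rewrite [sigma 1 _ * _]mulrC sigma1_mulmx_ge //.
  by rewrite r2_gt0.
have ABC_ge : sigma r1 A * sigma 1 (B *m C) * cos_theta DA r1 DBC 1
    <= sigma 1 (A *m (B *m C)).
  by rewrite sigma1_mulmx_ge ?entries_gt0 ?r1_gt0.
have block_le : sigma 1 (A *m (B *m C)) <= sigma 1 (hessian (loss phi ell) theta).
  rewrite mulmxA -block_eq; apply: sigma1_mxsub_le => a b ab; apply: val_inj.
    by move/eqP: (congr1 val ab); rewrite tagnat.eq_Rank eqxx => /eqP.
  by move/eqP: (congr1 val ab); rewrite tagnat.eq_Rank eqxx => /eqP.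
apply: le_trans block_le; apply: le_trans ABC_ge.
have -> : sigma r1 A * sigma 1 B * sigma r2 C * cos_theta DA r1 DBC 1
      * cos_theta DB 1 DC r2 =
    sigma r1 A * (sigma 1 B * sigma r2 C * cos_theta DB 1 DC r2)
      * cos_theta DA r1 DBC 1 by ring.
by rewrite ler_wpM2r ?ler_wpM2l ?sigma_ge0.
Qed.
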